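(* Let $\Bbbk$ be a unital commutative ring and let $n\ge 1$. There is an isomorphism of algebras $\Bbbk \mathrm{C}_{n+1}\simeq\Bbbk[\preceq_n]$, where $\mathrm{C}_{n+1}$ is the Catalan monoid and $\Bbbk[\preceq_n]$ is the incidence algebra of the poset of subsets of $\{1,\ldots,n\}$ ordered by $\preceq_n$. In particular, $\Bbbk \mathrm{C}_{n+1}$ is an incidence algebra.
   Context: Write $[n]=\{1,\ldots,n\}$. The Catalan monoid $\mathrm{C}_{n}$ is the monoid, under composition $(fg)(i)=f(g(i))$, of all functions $f:[n]\to[n]$ that are order-preserving ($i\le j\implies f(i)\le f(j)$) and order-increasing ($i\le f(i)$ for all $i$). $\Bbbk \mathrm{C}_{n+1}$ denotes its monoid algebra over $\Bbbk$. The partial order $\preceq_n$ on subsets of $[n]$: for $X=\{x_1<\cdots<x_k\}$ and $Y=\{y_1<\cdots<y_r\}$, $X\preceq_n Y$ iff $k=r$ and $x_i\le y_i$ for every $1\le i\le k$. For a principally finite partial order $\preceq$ (every $\{x'\mid x'\preceq x\}$ is finite) on a set, the incidence algebra $\Bbbk[\preceq]$ consists of all functions $f:\preceq\,\to\Bbbk$ (with $\preceq$ viewed as a set of ordered pairs), with pointwise addition and multiplication $(f\star g)(a,b)=\sum_{a\preceq c\preceq b}f(a,c)g(c,b)$. *)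

(* Defs.v *)
From HB Require Import structures.
From mathcomp Require Import all_boot all_order all_algebra.
From mathcomp Require Import all_classical.
Set Implicit Arguments.
Unset Strict Implicit.
Unset Printing Implicit Defensive.
Import Order.TTheory GRing.Theory.
Local Open Scope ring_scope.

(* K may be the zero ring, whereas [algType] and [{lrmorphism _ -> _}] require
   1 != 0; so the algebras below carry their pzRingType and lmodType structures
   and the compatibility of the two is given by the [_scaleAl] and [_scaleAr]
   lemmas. *)

HB.structure Definition FinMonoid := {M of Monoid M & Finite M}.
Notation finMonoidType := FinMonoid.type.

(* The monoid is finite, so an element of its algebra is an arbitrary family
   of coefficients: [f] stands for the formal sum of the f(m) m. *)
Definition monoid_algebra (K : Type) (M : finMonoidType) := {ffun M -> K}.

Section MonoidAlgebra.
Variables (K : comPzRingType) (M : finMonoidType).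
Local Notation A := (monoid_algebra K M).
Implicit Types f g h : A.

HB.instance Definition _ := GRing.Lmodule.copy A {ffun M -> K^o}.

Definition malg_one : A := [ffun m => (m == 1%g)%:R].

Definition malg_mul f g : A :=
  [ffun m => \sum_(x : M) \sum_(y : M | (x * y)%g == m) f x * g y].

Lemma malg_addE f g m : (f + g) m = f m + g m.
Proof. by rewrite ffunE. Qed.

Lemma malg_scaleE (k : K) f m : (k *: f) m = k * f m.
Proof. by rewrite ffunE. Qed.

Lemma malg_mulE f g m :
  malg_mul f g m = \sum_(x : M) \sum_(y : M) f x * g y *+ ((x * y)%g == m).
Proof.
rewrite ffunE; apply: eq_bigr => x _; rewrite big_mkcond.
by apply: eq_bigr => y _; case: eqP => _; rewrite ?mulr1n ?mulr0n.
Qed.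

Let sum_mul f g (F : M -> K) :
  \sum_m malg_mul f g m * F m =
  \sum_(x : M) \sum_(y : M) f x * g y * F (x * y)%g.
Proof.
under eq_bigr => m _ do rewrite malg_mulE mulr_suml.
rewrite exchange_big; apply: eq_bigr => x _.
under eq_bigr => m _ do rewrite mulr_suml.
rewrite exchange_big; apply: eq_bigr => y _ /=.
rewrite (bigD1 (x * y)%g) //= eqxx mulr1n [X in _ + X]big1 ?addr0 // => m.
by rewrite eq_sym => /negPf->; rewrite mulr0n mul0r.
Qed.

Fact malg_mulA : associative malg_mul.
Proof.
move=> f g h; apply/ffunP => m; rewrite [RHS]malg_mulE.
transitivity
    (\sum_x malg_mul f g x * (\sum_z h z *+ ((x * z)%g == m))); last first.
  apply: eq_bigr => x _; rewrite mulr_sumr.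
  by apply: eq_bigr => z _; rewrite mulrnAr.
rewrite sum_mul malg_mulE; apply: eq_bigr => x _.
transitivity (\sum_y malg_mul g h y * (f x *+ ((x * y)%g == m))).
  by apply: eq_bigr => y _; rewrite mulrnAr mulrC.
rewrite sum_mul; apply: eq_bigr => y _.
rewrite mulr_sumr; apply: eq_bigr => z _.
by rewrite mulgA !mulrnAr mulrC mulrA.
Qed.

Fact malg_mul1 : left_id malg_one malg_mul.
Proof.
move=> f; apply/ffunP => m; rewrite malg_mulE (bigD1 1%g) //= [X in _ + X]big1 ?addr0; last first.
  by move=> x /negPf x1; rewrite big1 // => y _; rewrite ffunE x1 mul0r mul0rn.
rewrite (bigD1 m) //= mul1g eqxx ffunE eqxx mul1r [X in _ + X]big1 ?addr0 // => y.
by move=> /negPf ym; rewrite mul1g ym.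
Qed.

Fact malg_mulr1 : right_id malg_one malg_mul.
Proof.
move=> f; apply/ffunP => m; rewrite malg_mulE exchange_big (bigD1 1%g) //= [X in _ + X]big1 ?addr0; last first.
  by move=> x /negPf x1; rewrite big1 // => y _; rewrite [malg_one _]ffunE x1 mulr0 mul0rn.
rewrite (bigD1 m) //= mulg1 eqxx ffunE eqxx mulr1 [X in _ + X]big1 ?addr0 // => y.
by move=> /negPf ym; rewrite mulg1 ym.
Qed.

Fact malg_mulDl : left_distributive malg_mul +%R.
Proof.
move=> f g h; apply/ffunP => m; rewrite malg_addE !malg_mulE -big_split.
apply: eq_bigr => x _; rewrite -big_split; apply: eq_bigr => y _.
by rewrite malg_addE mulrDl mulrnDl.
Qed.

Fact malg_mulDr : right_distributive malg_mul +%R.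
Proof.
move=> f g h; apply/ffunP => m; rewrite malg_addE !malg_mulE -big_split.
apply: eq_bigr => x _; rewrite -big_split; apply: eq_bigr => y _.
by rewrite malg_addE mulrDr mulrnDl.
Qed.

HB.instance Definition _ := GRing.Zmodule_isPzRing.Build A
  malg_mulA malg_mul1 malg_mulr1 malg_mulDl malg_mulDr.

Fact malg_scaleAl (k : K) f g : k *: (f * g) = (k *: f) * g.
Proof.
apply/ffunP => m; rewrite malg_scaleE [(f * g) m]malg_mulE [RHS]malg_mulE mulr_sumr.
apply: eq_bigr => x _; rewrite mulr_sumr; apply: eq_bigr => y _.
by rewrite malg_scaleE mulrnAr mulrA.
Qed.

Fact malg_scaleAr (k : K) f g : k *: (f * g) = f * (k *: g).
Proof.
apply/ffunP => m; rewrite malg_scaleE [(f * g) m]malg_mulE [RHS]malg_mulE mulr_sumr.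
apply: eq_bigr => x _; rewrite mulr_sumr; apply: eq_bigr => y _.
by rewrite malg_scaleE mulrnAr mulrCA.
Qed.

End MonoidAlgebra.

HB.mixin Record isPrincipallyFinite d T of Order.POrder d T := {
  principally_finite : forall x : T, finite_set [set y : T | (y <= x)%O]
}.

#[short(type="pfPOrderType")]
HB.structure Definition PFPOrder d :=
  {T of isPrincipallyFinite d T & Order.POrder d T}.

Definition incidence (K : Type) d (P : porderType d) :=
  {p : P * P | (p.1 <= p.2)%O} -> K.

(* f(a, b), extended by 0 to the pairs with a </= b *)
Definition inc_val (K : pzRingType) d (P : porderType d)
    (f : incidence K P) (a b : P) : K :=
  if insub (a, b) is Some p then f p else 0.

Section IncidenceAlgebra.
Variables (K : comPzRingType) (d : Order.disp_t) (P : pfPOrderType d).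
Local Notation A := (incidence K P).
Implicit Types f g h : A.

HB.instance Definition _ :=
  GRing.Lmodule.copy A ({p : P * P | (p.1 <= p.2)%O} -> K^o).

Definition inc_one : A := fun p => ((val p).1 == (val p).2)%:R.

Definition inc_mul f g : A := fun p =>
  \sum_(c \in [set c : P | ((val p).1 <= c <= (val p).2)%O])
     inc_val f (val p).1 c * inc_val g c (val p).2.

Lemma inc_valT f a b (ab : (a <= b)%O) : inc_val f a b =
  f (exist (fun p : P * P => (p.1 <= p.2)%O) (a, b) ab).
Proof.
rewrite /inc_val; case: insubP => [p _ pE|]; last by rewrite /= ab.
by congr f; apply: val_inj.
Qed.

Lemma inc_valF f a b : ~~ (a <= b)%O -> inc_val f a b = 0.
Proof. by move=> ab; rewrite /inc_val insubN. Qed.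

Lemma inc_val_inj f g : (forall a b, inc_val f a b = inc_val g a b) -> f = g.
Proof. by move=> fg; apply/funext => -[[a b] ab]; rewrite -!inc_valT. Qed.

Lemma inc_valD f g a b : inc_val (f + g) a b = inc_val f a b + inc_val g a b.
Proof.
case: (boolP (a <= b)%O) => ab; first by rewrite !(inc_valT _ ab).
by rewrite !(inc_valF _ ab) addr0.
Qed.

Lemma inc_valZ k f a b : inc_val (k *: f) a b = k * inc_val f a b.
Proof.
case: (boolP (a <= b)%O) => ab; first by rewrite !(inc_valT _ ab).
by rewrite !(inc_valF _ ab) mulr0.
Qed.

Lemma inc_val1 a b : inc_val inc_one a b = (a == b)%:R.
Proof.
case: (boolP (a <= b)%O) => ab; first by rewrite inc_valT.
by rewrite inc_valF //; case: eqP ab => // ->; rewrite lexx.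
Qed.

Lemma inc_valM (r : seq P) f g a b : uniq r -> (forall c, (c <= b)%O -> c \in r) ->
  inc_val (inc_mul f g) a b = \sum_(c <- r) inc_val f a c * inc_val g c b.
Proof.
move=> r_uniq rb.
have F0 c : ~~ (a <= c <= b)%O -> inc_val f a c * inc_val g c b = 0.
  by rewrite negb_and => /orP[] nle; rewrite (inc_valF _ nle) ?mul0r ?mulr0.
case: (boolP (a <= b)%O) => ab; last first.
  rewrite inc_valF // big1_seq // => c _; apply: F0; apply: contra ab.
  by case/andP; apply: le_trans.
rewrite inc_valT /inc_mul /=; apply: fsbig_fwiden => //.
  by move=> c /= /andP[_ /rb].
by move=> c [_ /= /negP/F0].
Qed.

Let downseq (b : P) :
  exists2 r : seq P, uniq r & forall c, (c <= b)%O -> c \in r.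
Proof.
have /finite_seqP[r rE] := principally_finite b.
exists (undup r) => [|c cb]; first exact: undup_uniq.
have : [set y : P | (y <= b)%O]%classic c by [].
by rewrite rE mem_undup.
Qed.

Fact inc_mulA : associative inc_mul.
Proof.
move=> f g h; apply: inc_val_inj => a b; have [r ur rb] := downseq b.
rewrite !(inc_valM _ _ _ ur rb).
have valMr k l x c : (c <= b)%O -> inc_val (inc_mul k l) x c =
    \sum_(e <- r) inc_val k x e * inc_val l e c.
  by move=> cb; apply: inc_valM => // e /le_trans/(_ cb)/rb.
under eq_bigr => c _ do rewrite (inc_valM g h c ur rb) mulr_sumr.
rewrite exchange_big; apply: eq_bigr => c _ /=.
case: (boolP (c <= b)%O) => cb; last first.
  by rewrite (inc_valF h) // mulr0 big1 // => e _; rewrite !mulr0.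
by rewrite valMr // mulr_suml; apply: eq_bigr => e _; rewrite mulrA.
Qed.

Fact inc_mul1 : left_id inc_one inc_mul.
Proof.
move=> f; apply: inc_val_inj => a b; have [r ur rb] := downseq b.
rewrite (inc_valM _ _ _ ur rb); case: (boolP (a \in r)) => ar.
  rewrite (bigD1_seq a) //= inc_val1 eqxx mul1r [X in _ + X]big1 ?addr0 // => c.
  by rewrite eq_sym => /negPf ca; rewrite inc_val1 ca mul0r.
rewrite big1_seq => [|c /andP[_ cr]].
  by rewrite inc_valF //; apply: contra ar => /rb.
by rewrite inc_val1; case: eqP ar => [->|]; rewrite ?cr ?mul0r.
Qed.

Fact inc_mulr1 : right_id inc_one inc_mul.
Proof.
move=> f; apply: inc_val_inj => a b; have [r ur rb] := downseq b.
rewrite (inc_valM _ _ _ ur rb) (bigD1_seq b) ?rb //= inc_val1 eqxx mulr1.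
by rewrite [X in _ + X]big1 ?addr0 // => c /negPf cb; rewrite inc_val1 cb mulr0.
Qed.

Fact inc_mulDl : left_distributive inc_mul +%R.
Proof.
move=> f g h; apply: inc_val_inj => a b; have [r ur rb] := downseq b.
rewrite inc_valD !(inc_valM _ _ _ ur rb) -big_split.
by apply: eq_bigr => c _; rewrite inc_valD mulrDl.
Qed.

Fact inc_mulDr : right_distributive inc_mul +%R.
Proof.
move=> f g h; apply: inc_val_inj => a b; have [r ur rb] := downseq b.
rewrite inc_valD !(inc_valM _ _ _ ur rb) -big_split.
by apply: eq_bigr => c _; rewrite inc_valD mulrDr.
Qed.

HB.instance Definition _ := GRing.Zmodule_isPzRing.Build A
  inc_mulA inc_mul1 inc_mulr1 inc_mulDl inc_mulDr.

Fact inc_scaleAl (k : K) (f g : A) : k *: (f * g) = (k *: f) * g.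
Proof.
apply: inc_val_inj => a b; have [r ur rb] := downseq b.
rewrite inc_valZ !(inc_valM _ _ _ ur rb) mulr_sumr.
by apply: eq_bigr => c _; rewrite inc_valZ mulrA.
Qed.

Fact inc_scaleAr (k : K) (f g : A) : k *: (f * g) = f * (k *: g).
Proof.
apply: inc_val_inj => a b; have [r ur rb] := downseq b.
rewrite inc_valZ !(inc_valM _ _ _ ur rb) mulr_sumr.
by apply: eq_bigr => c _; rewrite inc_valZ mulrCA.
Qed.

End IncidenceAlgebra.

(* ['I_n] = {0, ..., n-1} plays the role of {1, ..., n} in what follows. *)

Record catalan (n : nat) := Catalan {
  catalan_fun :> {ffun 'I_n -> 'I_n};
  _ : [forall i : 'I_n, forall j : 'I_n,
         (i <= j)%N ==> (catalan_fun i <= catalan_fun j)%N]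
      && [forall i : 'I_n, (i <= catalan_fun i)%N]
}.

HB.instance Definition _ n := [isSub for @catalan_fun n].
HB.instance Definition _ n := [Finite of catalan n by <:].

Section Catalan.
Variable n : nat.
Implicit Types f g : catalan n.

Lemma catalan_homo f (i j : 'I_n) : (i <= j)%N -> (f i <= f j)%N.
Proof.
by case: f => f /= /andP[/forallP/(_ i)/forallP/(_ j)/implyP].
Qed.

Lemma catalan_incr f (i : 'I_n) : (i <= f i)%N.
Proof. by case: f => f /= /andP[_ /forallP]. Qed.

Fact catalan_one_subproof :
  [forall i : 'I_n, forall j : 'I_n, (i <= j)%N ==>
     ([ffun k : 'I_n => k] i <= [ffun k : 'I_n => k] j)%N]
  && [forall i : 'I_n, (i <= [ffun k : 'I_n => k] i)%N].
Proof.
apply/andP; split; apply/forallP => i; last by rewrite ffunE.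
by apply/forallP => j; rewrite !ffunE; apply/implyP.
Qed.

Fact catalan_mul_subproof f g :
  [forall i : 'I_n, forall j : 'I_n, (i <= j)%N ==>
     ([ffun k => f (g k)] i <= [ffun k => f (g k)] j)%N]
  && [forall i : 'I_n, (i <= [ffun k => f (g k)] i)%N].
Proof.
apply/andP; split; apply/forallP => i.
  apply/forallP => j; rewrite !ffunE; apply/implyP => ij.
  by do 2!apply: catalan_homo.
by rewrite ffunE (leq_trans (catalan_incr g i)) ?catalan_incr.
Qed.

Definition catalan_one : catalan n := Catalan catalan_one_subproof.
Definition catalan_mul f g : catalan n := Catalan (catalan_mul_subproof f g).

Fact catalan_mulA : associative catalan_mul.
Proof. by move=> f g h; apply: val_inj; apply/ffunP => i; rewrite /= !ffunE. Qed.

Fact catalan_mul1 : left_id catalan_one catalan_mul.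
Proof. by move=> f; apply: val_inj; apply/ffunP => i; rewrite /= !ffunE. Qed.

Fact catalan_mulr1 : right_id catalan_one catalan_mul.
Proof. by move=> f; apply: val_inj; apply/ffunP => i; rewrite /= !ffunE. Qed.

HB.instance Definition _ := isMonoid.Build (catalan n)
  catalan_mulA catalan_mul1 catalan_mulr1.

End Catalan.

Definition subset_poset (n : nat) := {set 'I_n}.

HB.instance Definition _ n := Finite.on (subset_poset n).

Fact subset_display : Order.disp_t. Proof. exact: Order.default_display. Qed.

Section SubsetPoset.
Variable n : nat.
Implicit Types X Y Z : subset_poset n.

Lemma sorted_enum_set X : sorted ltn [seq val i | i <- enum (X : {set 'I_n})].
Proof.
rewrite sorted_map /enum_mem -enumT; apply: sorted_filter.
  by move=> ? ? ?; apply: ltn_trans.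
by rewrite -sorted_map val_enum_ord iota_ltn_sorted.
Qed.

(* [enum X] lists the elements of X in increasing order, and [all2] is false
   on lists of different lengths. *)
Definition subset_le X Y : bool :=
  all2 (fun x y : 'I_n => (x <= y)%N)
    (enum (X : {set 'I_n})) (enum (Y : {set 'I_n})).

Fact subset_le_refl : reflexive subset_le.
Proof. by move=> X; rewrite /subset_le; elim: (enum _) => //= x s ->; rewrite leqnn. Qed.

Fact subset_le_anti : antisymmetric subset_le.
Proof.
move=> X Y; rewrite /subset_le => XY.
suff eXY : enum (X : {set 'I_n}) = enum (Y : {set 'I_n}).
  by apply/setP => i; rewrite -mem_enum eXY mem_enum.
elim: (enum _) (enum _) XY => [|x s IHs] [|y t] //= /andP[/andP[xy st] /andP[yx ts]].
by rewrite (IHs t) ?st //; congr cons; apply/val_inj/anti_leq; rewrite xy.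
Qed.

Fact subset_le_trans : transitive subset_le.
Proof.
move=> Y X Z; rewrite /subset_le.
elim: (enum _) (enum _) (enum _) => [|y t IHt] [|x s] [|z u] //=.
by move=> /andP[xy st] /andP[yz tu]; rewrite (leq_trans xy yz) (IHt s u).
Qed.

HB.instance Definition _ := Order.Le_isPOrder.Build subset_display
  (subset_poset n) subset_le_refl subset_le_anti subset_le_trans.

Fact subset_principally_finite X :
  finite_set [set Y : subset_poset n | (Y <= X)%O].
Proof. exact: finite_finset. Qed.

HB.instance Definition _ :=
  isPrincipallyFinite.Build subset_display (subset_poset n)
    subset_principally_finite.

End SubsetPoset.

(* Main.v *)
Require Import Defs.
From HB Require Import structures.
From mathcomp Require Import all_boot all_order all_algebra.
From mathcomp Require Import all_classical.
Set Implicit Arguments.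
Unset Strict Implicit.
Unset Printing Implicit Defensive.
Import GRing.Theory.

(** Let V be the free K-module on n+1 points modulo the line spanned by the
    last point.  An element f of the Catalan monoid fixes the last point, so it
    acts on V, hence on the exterior algebra of V, whose basis is indexed by the
    subsets X of the first n points.  As f preserves the order, no sign occurs:
    f sends the basis vector of X to that of f(X) when f is injective on X and
    f(X) avoids the last point, and to 0 otherwise.  In terms of increasing
    enumerations this says that applying f entrywise to the list X gives the
    list Y, which is the relation [moves f X Y].  As f is increasing it forces
    X <= Y, so f yields the 0-1 matrix of an element of the incidence algebra.

    Composition of functions and the product of the incidence algebra are in
    opposite orders, so f |-> [moves f] is an anti-morphism; it is corrected by
    the reversal i |-> n-1-i of the points, which is an anti-automorphism of the
    poset ([flip_anti]).  The result is the map [rep].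

    Bijectivity comes from a unitriangular matrix.  Record, for each value
    y < n of f, the greatest point of its fibre: this gives sets X and Y with
    [moves f X Y], and f is recovered as the step function sending i to the y_j
    whose x_j is the first element of X not below i, or to n if there is none.
    So the monoid is in bijection with the pairs X <= Y ([catalan_of_pair],
    [catalan_pair]).  If the step function of (X, Y) moves Z to W, then sending
    z to the first element of X not below z embeds Z into X; hence the sum of
    the z+1 is less than the sum of the x+1 unless (Z, W) = (X, Y)
    ([moves_weight]).  A 0-1 matrix with ones on the diagonal that is triangular
    for a weight function is invertible over any ring ([unitriangular_mx_bij]). *)

(** * Unitriangular 0-1 matrices *)

Section Unitriangular.
Local Open Scope ring_scope.
Variables (K : pzRingType) (I J : finType).
Variables (A : I -> J -> bool) (mu : J -> nat) (theta : J -> I).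
Hypothesis theta_surj : forall i, exists j, theta j = i.
Hypothesis A_diag : forall j, A (theta j) j.
Hypothesis A_lower : forall j k, A (theta j) k -> k = j \/ (mu k < mu j)%N.

(** Injectivity costs nothing: two indices with the same row would each have
    smaller weight than the other. *)
Lemma unitriangular_bij : bijective theta.
Proof.
rewrite -setTT_bijective; split=> // [j k _ _ jk|i _]; last first.
  by have [j <-] := theta_surj i; exists j.
have Ajk : A (theta j) k by rewrite jk A_diag.
have Akj : A (theta k) j by rewrite -jk A_diag.
have [->//|kj] := A_lower Ajk; have [->//|jk'] := A_lower Akj.
by have := ltn_trans kj jk'; rewrite ltnn.
Qed.

Definition bool_mx_apply (u : {ffun I -> K}) (j : J) : K :=
  \sum_i u i * (A i j)%:R.

(** The diagonal term is separated from the terms of larger weight, so that the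
    system can be solved by descending weight. *)
Lemma bool_mx_applyE u j :
  bool_mx_apply u j =
  u (theta j) + \sum_(k | (mu j < mu k)%N) u (theta k) * (A (theta k) j)%:R.
Proof.
rewrite /bool_mx_apply (reindex theta) /=; last exact/onW_bij/unitriangular_bij.
rewrite (bigD1 j) //= A_diag mulr1 [in LHS]big_mkcond [in RHS]big_mkcond /=.
congr (_ + _); apply: eq_bigr => k _; case: ifP => [kj|/negbFE/eqP->].
  case: (boolP (A (theta k) j)) => [/A_lower[jk|->//]|_]; last first.
    by rewrite mulr0 if_same.
  by rewrite jk eqxx in kj.
by rewrite ltnn.
Qed.

(** Back substitution.  It is carried out by hand, without determinants or
    linear algebra over a field, so that K may be any ring. *)
Lemma unitriangular_mx_bij : bijective bool_mx_apply.
Proof.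
have [psi thetaK psiK] := unitriangular_bij.
have mu_lt j : (mu j < (\max_k mu k).+1)%N by rewrite ltnS leq_bigmax.
rewrite -setTT_bijective; split=> // [u v _ _ uv|w _].
  suff uv_theta m j : (\max_k mu k < mu j + m)%N -> u (theta j) = v (theta j).
    apply/ffunP => i; rewrite -(psiK i).
    by apply: (uv_theta (\max_k mu k).+1); rewrite addnS ltnS leq_addl.
  elim: m j => [|m IHm] j jm; first by have := mu_lt j; rewrite ltnS leqNgt -(addn0 (mu j)) jm.
  have /(congr1 (fun f => f j)) := uv; rewrite !bool_mx_applyE.
  rewrite [X in _ = _ + X](eq_bigr (fun k => u (theta k) * (A (theta k) j)%:R)).
    exact: addIr.
  move=> k jk; rewrite IHm //; apply: leq_trans jm _.
  by rewrite addnS -addSn leq_add2r.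
(* Subtracting the image of u0 = y o theta^-1 cancels the entries of y of
   maximal weight, and alters only those of smaller weight. *)
suff onto m (y : J -> K) : (forall j, (m <= mu j)%N -> y j = 0) ->
    exists u, bool_mx_apply u = y.
  have [j wj|u <-] := onto (\max_k mu k).+1 w; last by exists u.
  by have := leq_trans (mu_lt j) wj; rewrite ltnn.
elim: m y => [|m IHm] y y0.
  exists [ffun=> 0]; apply/funext => j; rewrite y0 // /bool_mx_apply big1 // => i _.
  by rewrite ffunE mul0r.
pose u0 : {ffun I -> K} := [ffun i => y (psi i)].
have [j mj|u1 u1E] := IHm (y \- bool_mx_apply u0).
  rewrite /= bool_mx_applyE ffunE thetaK big1 ?addr0 ?subrr // => k jk.
  by rewrite ffunE thetaK y0 ?mul0r // (leq_ltn_trans mj).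
exists [ffun i => u0 i + u1 i]; apply/funext => j.
transitivity (bool_mx_apply u0 j + bool_mx_apply u1 j).
  by rewrite -big_split; apply: eq_bigr => i _; rewrite ffunE mulrDl.
by rewrite u1E /= addrC subrK.
Qed.

End Unitriangular.


(** * A weight on increasing lists *)

Section Weight.

(** The successor makes every entry count, 0 included; otherwise dropping the
    entry 0 would keep the weight. *)
Definition weight (s : seq nat) := sumn (map S s).

Lemma weight_subseq s t : subseq s t -> s = t \/ weight s < weight t.
Proof.
rewrite /weight; elim: t s => [|y t IHt] [|x s]; rewrite /= ?addSn; auto.
case: eqP => [-> /IHt[->|st]|_ /IHt[<-|st]]; [by left | right..] => /=.
- by rewrite ltnS ltn_add2l.
- by rewrite ltnS leq_addl.
- by rewrite (leq_trans st) // -addSn leq_addl.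
Qed.

Lemma weight_all2 s t : all2 leq s t -> s = t \/ weight s < weight t.
Proof.
rewrite /weight; elim: s t => [|x s IHs] [|y t] //=; first by left.
rewrite leq_eqVlt => /andP[/predU1P[->|xy] /IHs[->|st]]; [by left | right..].
- by rewrite ltn_add2l.
- by rewrite ltn_add2r.
- by rewrite -addnS leq_add // ltnW.
Qed.

Lemma sorted_sub_subseq s t :
  sorted ltn s -> sorted ltn t -> {subset s <= t} -> subseq s t.
Proof.
move=> s_sorted t_sorted st; suff -> : s = [seq x <- t | x \in s] by apply: filter_subseq.
apply: (irr_sorted_eq ltn_trans ltnn) => // [|x].
  exact: (sorted_filter ltn_trans).
by rewrite mem_filter /=; case: (boolP (x \in s)) => // /st.
Qed.

End Weight.

(** * Step functions *)

Section Step.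
Variable n : nat.
Implicit Types (s t : seq nat) (i j : nat).

(** For increasing s and t of the same length, i goes to the entry of t facing
    the first entry of s that is at least i.  The default n is the top point,
    reached by the i beyond all of s.  In particular [step s s] rounds i up to
    an element of s. *)
Definition step s t i := nth n t (find (leq i) s).

Lemma find_leq_homo s : {homo (fun i => find (leq i) s) : i j / i <= j}.
Proof. by move=> i j ij; apply: sub_find => x; apply: leq_trans. Qed.

Lemma find_leq_mem s x : sorted ltn s -> x \in s -> find (leq x) s = index x s.
Proof.
elim: s => //= y s IHs ys; rewrite inE eq_sym.
case: eqP => [->|_ /= xs]; first by rewrite leqnn.
have s_sorted := path_sorted ys; rewrite IHs //.
by have /allP/(_ x xs) := order_path_min ltn_trans ys; rewrite /= ltnNge => /negPf->.
Qed.

Lemma nth_lt_homo t : sorted ltn t -> all (ltn^~ n) t ->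
  {homo nth n t : i j / i <= j}.
Proof.
move=> t_sorted t_lt i j ij; case: (ltnP j (size t)) => jt.
  rewrite (sorted_leq_nth leq_trans leqnn) ?inE ?(leq_ltn_trans ij) //.
  exact: sub_sorted ltnW _ t_sorted.
rewrite [X in _ <= X]nth_default //; case: (ltnP i (size t)) => it.
  by apply: ltnW; apply: (all_nthP n t_lt).
by rewrite nth_default.
Qed.

Lemma step_le s t i : all (ltn^~ n) t -> step s t i <= n.
Proof.
move=> t_lt; rewrite /step; case: (ltnP (find (leq i) s) (size t)) => it.
  by apply: ltnW; apply: (all_nthP n t_lt).
by rewrite nth_default.
Qed.

Lemma step_homo s t : sorted ltn t -> all (ltn^~ n) t ->
  {homo step s t : i j / i <= j}.
Proof. by move=> t_s t_lt i j ij; apply: nth_lt_homo => //; apply: find_leq_homo. Qed.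

Lemma step_incr s t i : all2 leq s t -> i <= n -> i <= step s t i.
Proof.
rewrite all2E => /andP[/eqP st /(all_nthP (n, n))].
rewrite size_zip st minnn => le_st i_n; rewrite /step.
case: (ltnP (find (leq i) s) (size t)) => it; last by rewrite nth_default.
have := le_st _ it; rewrite nth_zip //=; apply: leq_trans.
by apply: (@nth_find _ n (leq i)); rewrite has_find st.
Qed.

Lemma map_step s t : sorted ltn s -> size s = size t -> map (step s t) s = t.
Proof.
move=> s_sorted st; apply: (@eq_from_nth _ n) => [|j]; rewrite size_map // => js.
rewrite (nth_map n) // /step find_leq_mem ?mem_nth // index_uniq //.
exact: sorted_uniq ltn_trans ltnn _ s_sorted.
Qed.

Lemma step_min s i k : sorted ltn s -> all (ltn^~ n) s ->
  k \in s -> i <= k -> step s s i <= k.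
Proof.
move=> s_sorted s_lt ks ik; rewrite -[X in _ <= X](nth_index n ks).
by apply: nth_lt_homo => //; rewrite -find_leq_mem // find_leq_homo.
Qed.

Lemma step_support s t i : size s = size t -> all (ltn^~ n) t ->
  step s t i < n -> step s s i \in s.
Proof.
move=> st t_lt; rewrite /step; case: (ltnP (find (leq i) s) (size s)) => [it _|it].
  exact: mem_nth.
by rewrite nth_default ?ltnn // -st.
Qed.

(** Rounding up to s is strictly increasing wherever [step s t] is: the two
    functions of i depend only on the position found in s. *)
Lemma step_reflect s t i j : size s = size t -> sorted ltn s ->
  sorted ltn t -> all (ltn^~ n) t -> step s t j < n ->
  step s t i < step s t j -> step s s i < step s s j.
Proof.
move=> st s_sorted t_sorted t_lt j_n ij.
have find_ij : find (leq i) s < find (leq j) s.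
  rewrite ltnNge; apply: contraL ij => ji; rewrite -leqNgt.
  exact: nth_lt_homo.
have find_j : find (leq j) s < size s.
  by rewrite ltnNge; apply: contraL j_n => sj; rewrite /step nth_default ?ltnn // -st.
by apply: (sorted_ltn_nth ltn_trans) => //; rewrite inE (ltn_trans find_ij).
Qed.

(** If the step function of s and t is injective on z and avoids n, then rounding
    up embeds z into s without decreasing any entry.  Both the rounding and the
    inclusion increase the weight unless they are equalities. *)
Lemma map_step_weight s t z : all2 leq s t -> sorted ltn s -> sorted ltn t ->
  all (ltn^~ n) t -> all (ltn^~ n) z ->
  all (ltn^~ n) (map (step s t) z) -> sorted ltn (map (step s t) z) ->
  z = s \/ weight z < weight s.
Proof.
move=> st s_sorted t_sorted t_lt z_lt.
have size_st : size s = size t by move: st; rewrite all2E => /andP[/eqP].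
rewrite all_map => stz_lt stz_sorted.
have hz_sub : subseq (map (step s s) z) s.
  apply: sorted_sub_subseq => // [|_ /mapP[x xz ->]]; last first.
    by apply: (step_support size_st t_lt); apply: (allP stz_lt).
  move: stz_sorted; rewrite !sorted_map => stz_sorted; move: stz_lt stz_sorted.
  by apply: (@sub_in_sorted _ [pred x | step s t x < n]) => x y _ /= y_n; apply: step_reflect.
have z_hz : all2 leq z (map (step s s) z).
  have ss : all2 leq s s by elim: (s) => //= x s' ->; rewrite leqnn.
  elim: z z_lt {stz_lt stz_sorted hz_sub} => //= x z IHz /andP[x_n /IHz->].
  by rewrite andbT step_incr // ltnW.
case: (weight_all2 z_hz) (weight_subseq hz_sub) => [<-|lt_z]; first by auto.
by case=> [<-|/(ltn_trans lt_z)]; right.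
Qed.

End Step.

(** * Subsets as increasing lists, and their reversal *)

Section Elements.
Variable n : nat.
Implicit Types X Y Z W : subset_poset n.

Definition elts X : seq nat := [seq val i | i <- enum (X : {set 'I_n})].

Lemma elts_sorted X : sorted ltn (elts X). Proof. exact: sorted_enum_set. Qed.

Lemma elts_lt X : all (ltn^~ n) (elts X).
Proof. by apply/allP => _ /mapP[i _ ->] /=. Qed.

Lemma mem_elts X (i : 'I_n) : (val i \in elts X) = (i \in (X : {set 'I_n})).
Proof. by rewrite mem_map ?mem_enum //; apply: val_inj. Qed.

Lemma elts_inj : injective elts.
Proof. by move=> X Y XY; apply/setP => i; rewrite -!mem_elts XY. Qed.

Lemma elts_onto s : sorted ltn s -> all (ltn^~ n) s -> exists X, elts X = s.
Proof.
move=> s_sorted /allP s_lt; pose X : {set 'I_n} := [set i | val i \in s].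
exists X; apply: (irr_sorted_eq ltn_trans ltnn) => // [|x]; first exact: elts_sorted.
case: (ltnP x n) => x_n; first by rewrite (mem_elts X (Ordinal x_n)) inE.
apply/idP/idP => [/(allP (elts_lt X))|/s_lt] /=; by rewrite ltnNge x_n.
Qed.

Lemma subset_leE X Y : (X <= Y)%O = all2 leq (elts X) (elts Y).
Proof.
rewrite (_ : (X <= Y)%O = subset_le X Y) // /subset_le /elts.
by elim: (enum _) (enum _) => [|x s IHs] [|y t] //=; rewrite IHs.
Qed.

Definition flip X : subset_poset n := [set rev_ord i | i in (X : {set 'I_n})].

Lemma flipK : involutive flip.
Proof.
move=> X; rewrite /flip -imset_comp -[RHS](imset_id X).
by apply: eq_imset => i /=; rewrite rev_ordK.
Qed.

Lemma elts_flip X : elts (flip X) = rev [seq n - i.+1 | i <- elts X].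
Proof.
apply: (irr_sorted_eq ltn_trans ltnn); first exact: elts_sorted.
  rewrite rev_sorted; apply: (homo_sorted_in _ (elts_lt X) (elts_sorted X)).
  by move=> i j /= i_n j_n ij; apply: ltn_sub2l => //; apply: leq_ltn_trans ij j_n.
move=> x; rewrite mem_rev.
apply/mapP/mapP => [[i]|[j]].
  rewrite mem_enum => /imsetP[j jX ->] ->; exists (val j) => //.
  by rewrite mem_elts.
case/mapP => i iX -> ->; exists (rev_ord i) => //.
by move: iX; rewrite !mem_enum; apply: imset_f.
Qed.

(** Reversal makes entries complementary and reads both lists backwards, so the
    same pairs of entries are compared, the other way round. *)
Lemma flip_anti X Y : (X <= Y)%O -> (flip Y <= flip X)%O.
Proof.
rewrite !subset_leE !elts_flip; move: (elts X) (elts Y) => s t.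
rewrite !all2E => /andP[/eqP st le_st].
rewrite !size_rev !size_map st eqxx -rev_zip ?size_map // all_rev.
apply/(all_nthP (0, 0)) => j; rewrite size_zip !size_map st minnn => jt.
have /(all_nthP (0, 0)) := le_st; rewrite size_zip st minnn => /(_ j jt).
rewrite !nth_zip ?size_map //= !(nth_map 0) ?st // => st_j.
by rewrite leq_sub2l.
Qed.

End Elements.

(** * The action of the Catalan monoid on subsets *)

Section Action.
Variable n : nat.
Implicit Types (f g : catalan n.+1) (X Y Z W : subset_poset n) (i j : nat).

(** Extending f by the identity beyond n makes it an increasing, order-preserving
    map on all natural numbers, so that no range condition is needed when it is
    applied to lists. *)
Definition act f (i : nat) : nat := if i <= n then val (f (inord i)) else i.

Lemma act_le f i : (act f i <= n) = (i <= n).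
Proof. by rewrite /act; case: ifP => // i_n; rewrite -ltnS ltn_ord. Qed.

Lemma act_incr f i : i <= act f i.
Proof.
rewrite /act; case: ifP => // i_n.
by have := catalan_incr f (inord i); rewrite inordK.
Qed.

Lemma act_homo f : {homo act f : i j / (i <= j)%N}.
Proof.
move=> i j ij; case: (leqP j n) => jn; last first.
  rewrite [X in _ <= X]/act [j <= n]leqNgt jn /=; case: (leqP i n) => i_n.
    by rewrite (leq_trans _ (ltnW jn)) // act_le.
  by rewrite /act [i <= n]leqNgt i_n.
have i_n := leq_trans ij jn; rewrite /act i_n jn.
by apply: catalan_homo; rewrite !inordK.
Qed.

Lemma act1 i : act 1%g i = i.
Proof. by rewrite /act; case: ifP => // i_n; rewrite /= ffunE /= inordK. Qed.

Lemma actM f g i : act (f * g)%g i = act f (act g i).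
Proof.
rewrite /act; case i_n: (i <= n); last by rewrite i_n.
by rewrite -[_ <= n]ltnS ltn_ord /= ffunE inord_val.
Qed.

Lemma act_inj f g : (forall i, i <= n -> act f i = act g i) -> f = g.
Proof.
move=> fg; apply/val_inj/ffunP => i; apply: val_inj.
by have := fg i; rewrite /act -ltnS ltn_ord inord_val; apply.
Qed.

Lemma act_onto (F : nat -> nat) : {homo F : i j / i <= j} ->
    (forall i, i <= n -> i <= F i <= n) ->
  exists f, forall i, i <= n -> act f i = F i.
Proof.
move=> F_homo F_n; pose f : {ffun 'I_n.+1 -> 'I_n.+1} := [ffun i => inord (F (val i))].
have fE (i : 'I_n.+1) : f i = F i :> nat.
  by rewrite ffunE inordK // ltnS; case/andP: (F_n i (ltn_ord i)).
have f_catalan : [forall i : 'I_n.+1, forall j : 'I_n.+1, (i <= j) ==> (f i <= f j)]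
    && [forall i : 'I_n.+1, i <= f i].
  apply/andP; split; apply/forallP => i.
    by apply/forallP => j; apply/implyP => ij; rewrite !fE F_homo.
  by rewrite fE; case/andP: (F_n i (ltn_ord i)).
exists (Catalan f_catalan) => i i_n.
by rewrite /act i_n /= fE inordK.
Qed.

(** The list on the right has no repetition and all its entries are below n, so
    the equation also says that f is injective on X and avoids the point n. *)
Definition moves f X Y := map (act f) (elts X) == elts Y.

Lemma moves_le f X Y : moves f X Y -> (X <= Y)%O.
Proof.
rewrite subset_leE => /eqP <-; elim: (elts X) => //= x s ->.
by rewrite andbT act_incr.
Qed.

Lemma moves1 X Y : moves 1%g X Y = (X == Y).
Proof.
by rewrite /moves (eq_map act1) map_id (inj_eq (@elts_inj n)).
Qed.

(** The only candidate for Z is the list of the images of X under g.  This list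
    enumerates a subset: since f is order-preserving and increasing, strict
    growth and the bound n descend to it from its image Y under f. *)
Lemma movesM f g X Y :
  moves (f * g)%g X Y <-> exists2 Z, moves g X Z & moves f Z Y.
Proof.
have fgE : map (act (f * g)%g) (elts X) = map (act f) (map (act g) (elts X)).
  by rewrite -map_comp; apply: eq_map => i /=; rewrite actM.
split=> [|[Z /eqP gZ /eqP fY]]; last by apply/eqP; rewrite fgE gZ fY.
rewrite /moves fgE => /eqP fgY.
have [||Z ZE] := @elts_onto n (map (act g) (elts X)).
- have := elts_sorted Y; rewrite -fgY sorted_map.
  apply: sub_sorted => i j /=; rewrite !ltnNge; apply: contra; exact: act_homo.
- have := elts_lt Y; rewrite -fgY all_map.
  by apply: sub_all => i /=; apply/leq_ltn_trans/act_incr.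
by exists Z; rewrite ZE // fgY.
Qed.

Lemma moves_fun f X Y Z : moves f X Y -> moves f X Z -> Y = Z.
Proof. by move=> /eqP fY /eqP fZ; apply: elts_inj; rewrite -fY. Qed.

Lemma catalan_of_pair X Y : (X <= Y)%O ->
  exists f, forall i, i <= n -> act f i = step n (elts X) (elts Y) i.
Proof.
rewrite subset_leE => XY; apply: act_onto => [|i i_n].
  exact/step_homo/elts_lt/elts_sorted.
by rewrite step_incr ?step_le ?elts_lt.
Qed.

(** X is the set of the ascents of f, that is of the greatest points of the
    fibres of f over the values below n, and Y is its image.  Between i and the
    next ascent f is constant, so f is the step function of X and Y. *)
Lemma catalan_pair f : exists X Y, (X <= Y)%O /\
  forall i, i <= n -> act f i = step n (elts X) (elts Y) i.
Proof.
pose s := [seq i <- iota 0 n | act f i < act f i.+1].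
have s_sorted : sorted ltn s by rewrite (sorted_filter ltn_trans) // iota_ltn_sorted.
have s_lt : all (ltn^~ n) s.
  by apply/allP => i; rewrite mem_filter mem_iota => /andP[_].
have [X XE] := elts_onto s_sorted s_lt.
have [||Y YE] := @elts_onto n (map (act f) s).
- apply: (@homo_sorted_in _ _ [pred i | act f i < act f i.+1]) s_sorted.
    by move=> i j /= fi _ ij; apply: leq_trans fi _; apply: act_homo.
  exact: filter_all.
- rewrite all_map; apply/allP => i; rewrite mem_filter mem_iota => /andP[fi i_n] /=.
  by apply: leq_trans fi _; rewrite act_le.
have fn : act f n = n by apply/anti_leq; rewrite act_le act_incr leqnn.
have stepE i : step n s (map (act f) s) i = act f (step n s s i).
  rewrite /step; case: (ltnP (find (leq i) s) (size s)) => it.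
    by rewrite (nth_map n).
  by rewrite !nth_default ?size_map.
have act_step i : i <= n -> act f (step n s s i) = act f i.
  move=> i_n; have le_i : i <= step n s s i.
    by apply: step_incr i_n; elim: (s) => //= x s' ->; rewrite leqnn.
  have step_n := step_le s i s_lt.
  suff const d : i + d <= step n s s i -> act f (i + d) = act f i.
    by have := const (step n s s i - i); rewrite subnKC //; apply.
  elim: d => [|d IHd]; rewrite ?addn0 // addnS => id_step.
  rewrite -IHd; last exact: ltnW.
  have : i + d \notin s.
    by apply: contraL id_step => ids; rewrite -leqNgt step_min // leq_addr.
  rewrite mem_filter mem_iota add0n /= (leq_trans id_step) // andbT -leqNgt => f_id.
  by apply/anti_leq; rewrite f_id act_homo.
exists X, Y; split=> [|i i_n]; last by rewrite XE YE stepE act_step.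
by apply: (@moves_le f); rewrite /moves XE YE.
Qed.

Lemma moves_step f X Y : (X <= Y)%O ->
    (forall i, i <= n -> act f i = step n (elts X) (elts Y) i) ->
  moves f X Y.
Proof.
rewrite subset_leE all2E => /andP[/eqP sXY _] fE; apply/eqP.
rewrite -[RHS](map_step n (elts_sorted X) sXY); apply/eq_in_map => i iX.
by rewrite fE // ltnW //; apply: (allP (elts_lt X)).
Qed.

Lemma moves_weight f X Y Z W : (X <= Y)%O ->
    (forall i, i <= n -> act f i = step n (elts X) (elts Y) i) ->
  moves f Z W -> (Z = X /\ W = Y) \/ weight (elts Z) < weight (elts X).
Proof.
move=> XY fE fZW; have fXY := moves_step XY fE.
have ZW : map (step n (elts X) (elts Y)) (elts Z) = elts W.
  rewrite -(eqP fZW); apply/eq_in_map => i iZ.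
  by rewrite fE // ltnW //; apply: (allP (elts_lt Z)).
rewrite subset_leE in XY.
have := map_step_weight XY (elts_sorted X) (elts_sorted Y) (elts_lt Y)
  (elts_lt Z); rewrite ZW.
case/(_ (elts_lt W) (elts_sorted W)) => [ZX|]; last by right.
left; move/elts_inj: ZX fZW => -> /(moves_fun fXY)->.
by [].
Qed.

End Action.

(** * The isomorphism *)

Section Isomorphism.
Local Open Scope ring_scope.
Variables (K : comPzRingType) (n : nat).
Local Notation P := (subset_poset n).
Local Notation M := (catalan n.+1).
Local Notation pair := {p : P * P | (p.1 <= p.2)%O}.
Implicit Types (u v : monoid_algebra K M) (X Y Z : P).

(** The two components of the pair are exchanged because reversal inverts the
    order; this exchange turns the anti-morphism [moves] into a morphism. *)
Definition flip_moves (f : M) (p : pair) : bool :=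
  moves f (flip (val p).2) (flip (val p).1).

Definition rep u : incidence K P := bool_mx_apply flip_moves u.

Lemma inc_val_rep u X Y :
  inc_val (rep u) X Y = \sum_f u f * (moves f (flip Y) (flip X))%:R.
Proof.
case: (boolP (X <= Y)%O) => XY; first by rewrite inc_valT.
rewrite inc_valF // big1 // => f _; case: (boolP (moves _ _ _)) => [/moves_le|].
  by move/flip_anti; rewrite !flipK (negPf XY).
by rewrite mulr0.
Qed.

Fact rep_is_zmod_morphism : zmod_morphism rep.
Proof.
move=> u v; apply/funext => p.
rewrite [RHS](_ : _ = rep u p - rep v p) // /rep /bool_mx_apply -sumrB.
by apply: eq_bigr => f _; rewrite -mulrBl; congr (_ * _); rewrite !ffunE.
Qed.

Lemma rep_scalable : scalable rep.
Proof.
move=> k u; apply: inc_val_inj => X Y; rewrite inc_valZ !inc_val_rep mulr_sumr.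
by apply: eq_bigr => f _; rewrite malg_scaleE mulrA.
Qed.

Lemma sum_malg_mul u v (F : M -> K) :
  \sum_m (u * v) m * F m = \sum_f \sum_g u f * v g * F (f * g)%g.
Proof.
rewrite pair_big (partition_big (fun p => (p.1 * p.2)%g) predT) //=.
apply: eq_bigr => m _; rewrite ffunE pair_big_dep mulr_suml.
by apply: eq_bigr => p /eqP->.
Qed.

(** At most one term of the sum is nonzero, since f and g act by partial
    functions: this is [movesM] read as a product of 0-1 matrices. *)
Lemma sum_moves (f g : M) X Y :
  \sum_(Z <- enum {: {set 'I_n}}) (moves f (flip Z) Y)%:R * (moves g X (flip Z))%:R
  = (moves (f * g)%g X Y)%:R :> K.
Proof.
case: (boolP (moves (f * g)%g X Y)) => [/movesM[Z gXZ fZY]|Nfg].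
  rewrite (bigD1_seq (flip Z : {set _})) ?enum_uniq ?mem_enum //= flipK gXZ fZY mulr1.
  rewrite big1 ?addr0 // => W WZ; case: (boolP (moves g X _)) => [|_]; last by rewrite mulr0.
  by move/(moves_fun gXZ) => ZW; rewrite ZW flipK eqxx in WZ.
rewrite big1 // => Z _; rewrite -natrM mulnb; case: andP => // -[fZY gXZ].
by case/negP: Nfg; apply/movesM; exists (flip Z).
Qed.

Fact rep_is_monoid_morphism : monoid_morphism rep.
Proof.
split=> [|u v]; apply: inc_val_inj => X Y.
  rewrite inc_val_rep inc_val1 (bigD1 1%g) //= big1 ?addr0 => [|f f1].
    by rewrite ffunE eqxx mul1r moves1 (inj_eq (inv_inj (@flipK n))) eq_sym.
  by rewrite ffunE (negPf f1) mul0r.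
rewrite (@inc_valM _ _ (subset_poset n) (enum {: {set 'I_n}})) => [||Z _]; last first.
- by rewrite mem_enum.
- exact: enum_uniq.
rewrite inc_val_rep sum_malg_mul.
under [RHS]eq_bigr => Z _.
  rewrite !inc_val_rep mulr_suml; under eq_bigr => f _ do rewrite mulr_sumr; over.
rewrite [RHS]exchange_big; apply: eq_bigr => f _; rewrite [RHS]exchange_big.
apply: eq_bigr => g _ /=; rewrite -sum_moves mulr_sumr.
by apply: eq_bigr => Z _; rewrite mulrACA.
Qed.

HB.instance Definition _ := GRing.isZmodMorphism.Build
  (monoid_algebra K M) (incidence K P) rep rep_is_zmod_morphism.
HB.instance Definition _ := GRing.isMonoidMorphism.Build
  (monoid_algebra K M) (incidence K P) rep rep_is_monoid_morphism.

Lemma rep_bij : bijective rep.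
Proof.
have theta_ex (p : pair) : exists f : M, forall i, (i <= n)%N ->
    act f i = step n (elts (flip (val p).2)) (elts (flip (val p).1)) i.
  exact/catalan_of_pair/flip_anti/(valP p).
have [theta thetaE] := choice theta_ex.
apply: (@unitriangular_mx_bij K M _ flip_moves
  (fun p => weight (elts (flip (val p).2))) theta) => [f|p|p q].
- have [X [Y [XY fE]]] := catalan_pair f.
  exists (exist (fun p : P * P => (p.1 <= p.2)%O) (flip Y, flip X) (flip_anti XY)).
  by apply: act_inj => i i_n; rewrite thetaE //= !flipK fE.
- exact: moves_step (flip_anti (valP p)) (thetaE p).
case/(moves_weight (flip_anti (valP p)) (thetaE p)) => [[q2 q1]|]; last by right.
left; apply: val_inj; rewrite [RHS]surjective_pairing [LHS]surjective_pairing.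
by congr (_, _); apply: (inv_inj (@flipK n)).
Qed.

End Isomorphism.

Theorem theorem6p11 (K : comPzRingType) (n : nat) (hn : (1 <= n)%N) :
  (exists f : {rmorphism monoid_algebra K (catalan n.+1)
                         -> incidence K (subset_poset n)},
     scalable f /\ bijective f)
  /\ (exists (d : Order.disp_t) (P : pfPOrderType d)
             (f : {rmorphism monoid_algebra K (catalan n.+1)
                             -> incidence K P}),
     scalable f /\ bijective f).
Proof.
split; first by exists (@rep K n); split; [apply: rep_scalable | apply: rep_bij].
exists _, (subset_poset n), (@rep K n).
by split; [apply: rep_scalable | apply: rep_bij].
Qed.
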